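(* Let $(T,d)$ be a complete metric space, let $\alpha>0$, for each $t\in T$ let $\mathcal{H}_t$ be a Hilbert space and let $A_t$ be a bounded self-adjoint linear operator on $\mathcal{H}_t$, such that $\sup_{t\in T}\|A_t\|<\infty$. Suppose that $A=(A_t)_{t\in T}$ is p2-$\alpha$-Hölder continuous. Then the edges of a spectral gap of $A$ are $\alpha$-Hölder continuous at $t_0\in T$ if this gap does not close at $t_0$. Explicitly: let $t_0\in T$, let $W$ be a neighborhood of $t_0$, and for $t\in W$ let $(a_t,b_t)$, $a_t<b_t$, be a gap of $\sigma(A_t)$, such that $\lim_{t\to t_0}a_t=a_{t_0}$ and $\lim_{t\to t_0}b_t=b_{t_0}$ (so $a_{t_0}<b_{t_0}$: the gap does not close at $t_0$). Then there are $C\ge 0$ and $r>0$ such that for all $t\in W$ with $d(t,t_0)<r$, $$|a_t-a_{t_0}|\le C\,d(t,t_0)^\alpha\quad\text{and}\quad |b_t-b_{t_0}|\le C\,d(t,t_0)^\alpha .$$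
   Context: $\sigma(B)$ denotes the spectrum of $B$. A gap of a closed set $F\subset\mathbb{R}$ is a bounded connected component of $\mathbb{R}\setminus F$, i.e. an interval $(a,b)$ with $-\infty<a<b<\infty$, $a,b\in F$, $(a,b)\cap F=\emptyset$; its edges are $a$ and $b$. Hölder functions: for metric spaces $(X,d_X)$, $(Y,d_Y)$ and $\alpha>0$, a function $f:X\to Y$ is $\alpha$-Hölder if $\mathrm{Hol}^\alpha(f)=\sup_{x\neq y}\frac{d_Y(f(x),f(y))}{d_X(x,y)^\alpha}<\infty$. A family $\mathcal{F}$ of functions $X\to Y$ is uniformly $\alpha$-Hölder if $\sup_{f\in\mathcal{F}}\mathrm{Hol}^\alpha(f)<\infty$. p2-$\alpha$-Hölder fields: for $M>0$ let $\mathscr{P}_2(M)$ be the set of polynomials $p(z)=p_0+p_1z+p_2z^2$ with $p_i\in\mathbb{R}$ and $\|p\|_1=|p_0|+|p_1|+|p_2|\le M$. The field $A$ is p2-$\alpha$-Hölder continuous if for every $M>0$ the maps $t\in T\mapsto\|p(A_t)\|$, $p\in\mathscr{P}_2(M)$, are uniformly $\alpha$-Hölder. *)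

(* Defs.v *)
From HB Require Import structures.
From mathcomp Require Export all_boot all_order all_algebra.
From mathcomp Require Export complex.
From mathcomp Require Export all_classical all_reals all_analysis.

Set Implicit Arguments.
Unset Strict Implicit.
Unset Printing Implicit Defensive.

Import Order.TTheory GRing.Theory Num.Theory.
Import numFieldNormedType.Exports.

Local Open Scope classical_set_scope.
Local Open Scope ring_scope.
Local Open Scope complex_scope.

#[short(type="completeMetricType")]
HB.structure Definition CompleteMetric (R : numDomainType) :=
  {T of Metric R T & Complete T}.

(* [inner] is linear in its first argument and conjugate-linear in its second;
   the norm is the one of the completeNormedModType, so that completeness of
   the space is completeness for the norm [sqrt (inner x x)]. *)
HB.mixin Record CompleteNormedModule_isHilbert (R : realType) H
    & CompleteNormedModule R[i] H := {
  inner : {dot H for (@Num.conj R[i])} ;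
  inner_norm : forall x : H, inner x x = `|x| ^+ 2
}.

#[short(type="hilbertType")]
HB.structure Definition Hilbert (R : realType) :=
  {H of CompleteNormedModule R[i] H & CompleteNormedModule_isHilbert R H}.

Section operators.
Variables (R : realType) (H : hilbertType R).

(* [`|x|] is an element of [R[i]] (with zero imaginary part). *)
Definition hnorm (x : H) : R := complex.Re `|x|.

Definition bounded_op (B : H -> H) : Prop :=
  exists M : R, forall x, hnorm (B x) <= M * hnorm x.

(* Only meaningful for bounded [B]: otherwise [sup] is its default value. *)
Definition opnorm (B : H -> H) : R :=
  sup [set hnorm (B x) | x in [set x : H | hnorm x <= 1]].

Definition self_adjoint (B : H -> H) : Prop :=
  forall x y : H, inner (B x) y = inner x (B y).

Definition spectrum (B : {linear H -> H}) : set R[i] :=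
  [set l | ~ exists S : {linear H -> H},
      [/\ bounded_op S,
          forall x, S (l *: x - B x) = x &
          forall x, l *: S x - B (S x) = x]].

(* The spectrum of a self-adjoint operator is a subset of the real line; this
   is the spectrum regarded as a set of reals. *)
Definition real_spectrum (B : {linear H -> H}) : set R :=
  [set x : R | spectrum B x%:C].

Definition poly_op (p : {poly R}) (B : H -> H) (x : H) : H :=
  \sum_(k < size p) (p`_k)%:C *: iter k B x.

End operators.

Definition gap (R : realType) (F : set R) (a b : R) : Prop :=
  [/\ a < b, F a, F b & `]a, b[%classic `&` F = set0].

(* If [X] has at most one point then the value is [-oo] instead of the
   customary [0]; it is smaller than [+oo] in both cases. *)
Definition hoelder_const (R : realType) (X Y : metricType R) (alpha : R)
    (f : X -> Y) : \bar R :=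
  ereal_sup [set (mdist (f z.1) (f z.2) / mdist z.1 z.2 `^ alpha)%:E
            | z in [set z : X * X | z.1 != z.2]].

Definition uniformly_hoelder (R : realType) (X Y : metricType R) (alpha : R)
    (F : set (X -> Y)) : Prop :=
  (ereal_sup [set hoelder_const alpha f | f in F] < +oo)%E.

Definition poly_norm1 (R : realType) (p : {poly R}) : R :=
  \sum_(k < size p) `|p`_k|.

Definition P2 (R : realType) (M : R) : set {poly R} :=
  [set p : {poly R} | (size p <= 3)%N /\ poly_norm1 p <= M].

Definition p2_hoelder (R : realType) (T : metricType R) (alpha : R)
    (H : T -> hilbertType R) (A : forall t, {linear H t -> H t}) : Prop :=
  forall M : R, 0 < M ->
    uniformly_hoelder alpha
      [set (fun t => opnorm (poly_op p (A t)) : R^o) | p in P2 M].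

(* Main.v *)
From HB Require Import structures.
Require Import Defs.
From mathcomp Require Import ring lra.

Set Implicit Arguments.
Unset Strict Implicit.
Unset Printing Implicit Defensive.

Import Order.TTheory GRing.Theory Num.Theory.
Import numFieldNormedType.Exports.

Local Open Scope classical_set_scope.
Local Open Scope ring_scope.
Local Open Scope complex_scope.

(** The idea is to read the distance from a point [c] to the spectrum off the
    norm of one quadratic polynomial: if [L] is large, then
      || (A - c)^2 - L || = L - dist(c, sigma(A))^2,
    since (lambda - c)^2 - L is negative on the spectrum and largest in absolute
    value where lambda is closest to c.  Place [c] inside the gap of A_{t0}, at
    a quarter of its length from the edge a_{t0}.  For [t] near [t0] the point
    of sigma(A_t) nearest to [c] is then still a_t, so the norm is
    L - (a_t - c)^2.  As the polynomial does not depend on [t], the hypothesis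
    bounds
      |(a_t - c)^2 - (a_{t0} - c)^2| = |a_t - a_{t0}| |a_t + a_{t0} - 2 c|
    by a multiple of d(t, t0)^alpha, and the last factor stays away from 0
    because the gap does not close.  The edge b is treated in the same way
    ([nearest_point_hoelder]).

    The norm formula ([opnorm_shift_sqr], [opnorm_quadratic]) is proved without
    functional calculus.  Everything is phrased by the property of being
    bounded from below, |f x| >= d |x| with d > 0, which passes to compositions,
    and hence from the factors of B^2 - s^2 = (B - s)(B + s) to the product.
    Three facts make this work for a bounded self-adjoint B.
    - A real [c] is in the spectrum iff B - c is not bounded from below
      ([real_spectrumP]).  The point is that B is onto if it is bounded from
      below; as B^2 is then at least d^2, the operator 1 - tau B^2 is a strict
      contraction for small tau > 0, and B^2 x = y is a fixed point problem.
    - One of B - N, B + N with N = ||B|| > 0 is not bounded from below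
      ([opnorm_approximate_eigenvalue]).
    - B^2 - c is bounded from below for c < 0 ([bounded_below_shift_sqr_lt0]).
    Let B = A - c and P = B^2 - L.  The second fact for P, with the third one
    for B and the factorization of B^2 - s^2, produces a point of the spectrum
    at distance at most (L - ||P||)^(1/2) from c; conversely, at a point of the
    spectrum A is almost a scalar on suitable vectors, which bounds ||P|| from
    below. *)

(** * The norm as a real number *)

Section real_norm.
Context {R : realType} {H : hilbertType R}.
Implicit Types (x y : H) (r : R).

Lemma hnormE x : `|x| = (hnorm x)%:C.
Proof. by rewrite /hnorm RRe_real// normr_real. Qed.

Lemma hnorm_ge0 x : 0 <= hnorm x.
Proof. by rewrite -ler0c -hnormE. Qed.

Lemma hnorm0 : hnorm (0 : H) = 0.
Proof. by rewrite /hnorm normr0. Qed.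

Lemma hnorm_gt0 x : (0 < hnorm x) = (x != 0).
Proof. by rewrite -ltcR -hnormE normr_gt0. Qed.

Lemma hnorm_eq0 x : hnorm x = 0 -> x = 0.
Proof. by move=> x0; apply/eqP; rewrite -normr_eq0 hnormE x0. Qed.

Lemma ler_hnormD x y : hnorm (x + y) <= hnorm x + hnorm y.
Proof. by rewrite -lecR rmorphD/= -!hnormE ler_normD. Qed.

Lemma hnorm_opp x : hnorm (- x) = hnorm x.
Proof. by rewrite /hnorm normrN. Qed.

Lemma ler_hnormB x y : hnorm (x - y) <= hnorm x + hnorm y.
Proof. by rewrite -(hnorm_opp y) ler_hnormD. Qed.

Lemma hdistC x y : hnorm (x - y) = hnorm (y - x).
Proof. by rewrite -hnorm_opp opprB. Qed.

Lemma hnormZ r x : hnorm (r%:C *: x) = `|r| * hnorm x.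
Proof.
apply: complexI; rewrite -hnormE normrZ rmorphM/= hnormE; congr (_ * _).
by rewrite normc_def/= expr0n addr0 sqrtr_sqr.
Qed.

Lemma hnorm_sqr x : hnorm x ^+ 2 = complex.Re (inner x x).
Proof. by rewrite inner_norm/= (hnormE x) -rmorphXn. Qed.

Lemma hnorm_sqrDZ r x y :
  hnorm (x + r%:C *: y) ^+ 2 =
  hnorm x ^+ 2 + 2 * r * complex.Re (inner x y) + r ^+ 2 * hnorm y ^+ 2.
Proof.
have conjE (z : R[i]) : z + z^* = (2 * complex.Re z)%:C.
  by rewrite addcJ rmorphM/= rmorph_nat.
have := hnormZ r y => /(congr1 (fun s => s ^+ 2)).
rewrite exprMn real_normK ?num_real// => <-.
rewrite -(mulrA 2).
have -> : r * complex.Re (inner x y) = complex.Re (inner x (r%:C *: y)).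
  rewrite linearZr/=; case: (inner x y) => u v /=.
  by rewrite oppr0 mul0r subr0.
by rewrite !hnorm_sqr dnormD conjE !raddfD/= addrAC.
Qed.

Lemma hnorm_le_sqrt r x y : hnorm x ^+ 2 <= r * hnorm y ^+ 2 ->
  hnorm x <= Num.sqrt r * hnorm y.
Proof.
have sqrE (z : H) : hnorm z = Num.sqrt (hnorm z ^+ 2).
  by rewrite sqrtr_sqr ger0_norm// hnorm_ge0.
move=> xy; rewrite sqrE [hnorm y]sqrE mulrC -sqrtrM ?sqr_ge0// mulrC.
exact: ler_wsqrtr.
Qed.

End real_norm.

(** * Translates of an operator *)

Definition shift (R : realType) (H : hilbertType R) (B : {linear H -> H})
    (c : R) (x : H) : H := B x - c%:C *: x.

Section shift_linear.
Variables (R : realType) (H : hilbertType R) (B : {linear H -> H}) (c : R).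

Lemma shift_is_linear : linear (shift B c).
Proof.
move=> k x y; rewrite /shift linearP !scalerDr !scalerA [_ * k]mulrC scalerN.
by rewrite opprD scalerA addrACA.
Qed.

HB.instance Definition _ :=
  GRing.isLinear.Build R[i] H H *:%R (shift B c) shift_is_linear.

End shift_linear.

Section shift_theory.
Context {R : realType} {H : hilbertType R}.
Implicit Types (B : {linear H -> H}) (b c : R).

Lemma shift_shift B b c x : shift (shift B b) c x = shift B (b + c) x.
Proof. by rewrite /shift/= rmorphD scalerDl opprD addrA. Qed.

Lemma shift_comp B b c x :
  shift B b (shift B c x) = B (B x) - (b + c)%:C *: B x + (b * c)%:C *: x.
Proof.
rewrite /shift linearB linearZ/= scalerBr scalerA rmorphD rmorphM/=.
rewrite scalerDl opprB opprD !addrA [LHS]addrAC; congr (_ + _).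
exact: addrAC.
Qed.

Lemma shift_sqr_factor B c x :
  shift (B \o B) (c ^+ 2) x = shift B c (shift B (- c) x).
Proof.
by rewrite shift_comp /shift/= subrr scale0r subr0 mulrN rmorphN scaleNr.
Qed.

End shift_theory.

(** * Operators bounded from below *)

Section bounded_self_adjoint.
Context {R : realType} {H : hilbertType R}.
Implicit Types (B : {linear H -> H}) (c k : R).

Lemma opnorm_bounded B : bounded_op B ->
  has_ubound [set hnorm (B x) | x in [set x : H | hnorm x <= 1]].
Proof.
move=> [M BM]; exists `|M| => _ [y /= y1 <-]; apply: le_trans (BM y) _.
apply: le_trans (ler_wpM2r (hnorm_ge0 y) (ler_norm M)) _.
by rewrite -[leRHS]mulr1 ler_wpM2l.
Qed.

Lemma bounded_opP B : bounded_op B ->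
  forall x, hnorm (B x) <= opnorm B * hnorm x.
Proof.
move=> Bb x; have [->|x0] := eqVneq x 0.
  by rewrite linear0 hnorm0 mulr0.
rewrite -ler_pdivrMr ?hnorm_gt0// mulrC.
have h0 : 0 <= (hnorm x)^-1 by rewrite invr_ge0 hnorm_ge0.
have -> : (hnorm x)^-1 * hnorm (B x) = hnorm (B ((hnorm x)^-1%:C *: x)).
  by rewrite linearZ/= hnormZ ger0_norm.
apply: ub_le_sup; first exact: opnorm_bounded.
exists ((hnorm x)^-1%:C *: x) => //=.
by rewrite hnormZ ger0_norm// mulVf// gt_eqF// hnorm_gt0.
Qed.

Lemma opnorm_le B k : 0 <= k ->
  (forall x, hnorm (B x) <= k * hnorm x) -> opnorm B <= k.
Proof.
move=> k0 Bk; apply: ge_sup.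
  by exists (hnorm (B 0)), 0 => //=; rewrite hnorm0.
move=> _ [y /= y1 <-]; apply: le_trans (Bk y) _.
by rewrite -[leRHS]mulr1 ler_wpM2l.
Qed.

Lemma opnorm_ge0 B : bounded_op B -> 0 <= opnorm B.
Proof.
move=> Bb; apply: ub_le_sup; first exact: opnorm_bounded.
by exists 0; rewrite /= ?linear0 hnorm0.
Qed.

Lemma bounded_shift B c : bounded_op B -> bounded_op (shift B c).
Proof.
move=> [M BM]; exists (M + `|c|) => x.
by rewrite (le_trans (ler_hnormB _ _))// hnormZ mulrDl lerD.
Qed.

Lemma hnorm_comp_le B : bounded_op B ->
  forall x, hnorm (B (B x)) <= opnorm B ^+ 2 * hnorm x.
Proof.
move=> Bb x; rewrite (le_trans (bounded_opP Bb _))// expr2 -mulrA.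
by rewrite ler_wpM2l ?opnorm_ge0 ?bounded_opP.
Qed.

Lemma bounded_sqr B : bounded_op B -> bounded_op (B \o B).
Proof. by move=> Bb; exists (opnorm B ^+ 2) => x; exact: hnorm_comp_le. Qed.

Lemma self_adjoint_shift B c : self_adjoint B -> self_adjoint (shift B c).
Proof.
move=> Bs x y; rewrite /shift linearBl linearBr/= Bs linearZr linearZl_LR/=.
by congr (_ - _ * _); apply/esym; exact: conjc_real.
Qed.

Lemma self_adjoint_sqr B : self_adjoint B -> self_adjoint (B \o B).
Proof. by move=> Bs x y; rewrite /= !Bs. Qed.

(** The three norm estimates below rest on this expansion.  Positivity of B^2
    enters here: the inner product of B^2 x with x is the square norm of B x. *)
Lemma hnorm_shift_sqr B c x : self_adjoint B ->
  hnorm (shift (B \o B) c x) ^+ 2 =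
  hnorm (B (B x)) ^+ 2 - 2 * c * hnorm (B x) ^+ 2 + c ^+ 2 * hnorm x ^+ 2.
Proof.
move=> Bs; rewrite /shift -scaleNr -rmorphN hnorm_sqrDZ /= Bs -hnorm_sqr.
by rewrite sqrrN mulrN mulNr.
Qed.

Definition bounded_below (f : H -> H) : Prop :=
  exists2 d : R, 0 < d & forall x, d * hnorm x <= hnorm (f x).

Lemma bounded_below_ext (f g : H -> H) : f =1 g ->
  bounded_below f -> bounded_below g.
Proof. by move=> /funext ->. Qed.

Lemma bounded_below_comp (f g : H -> H) :
  bounded_below f -> bounded_below g -> bounded_below (f \o g).
Proof.
move=> [d d0 fd] [e e0 ge]; exists (d * e); first exact: mulr_gt0.
by move=> x; rewrite -mulrA (le_trans _ (fd _))// ler_wpM2l// ltW.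
Qed.

Lemma bounded_below_inj B : bounded_below B -> injective B.
Proof.
move=> [d d0 Bd] x y Bxy; apply/eqP; rewrite -subr_eq0.
apply/eqP/hnorm_eq0/eqP; rewrite eq_le hnorm_ge0 andbT.
by rewrite -(pmulr_rle0 _ d0) (le_trans (Bd _))// linearB/= Bxy subrr hnorm0.
Qed.

Lemma bounded_below_shift B c k : (forall x, hnorm (B x) <= k * hnorm x) ->
  k < `|c| -> bounded_below (shift B c).
Proof.
move=> Bk kc; exists (`|c| - k); rewrite ?subr_gt0// => x.
rewrite mulrBl lerBlDr -hnormZ.
have -> : c%:C *: x = B x - shift B c x by rewrite /shift opprB addrC subrK.
rewrite [leRHS]addrC; apply: le_trans (ler_hnormB _ _) _.
by rewrite lerD2r.
Qed.

Lemma bounded_below_shift_sqr_lt0 B c :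
  bounded_op B -> self_adjoint B -> c < 0 -> bounded_below (shift (B \o B) c).
Proof.
move=> Bb Bs c0; exists (- c); rewrite ?oppr_gt0// => x.
rewrite -(@ler_pXn2r _ 2) ?nnegrE ?mulr_ge0 ?hnorm_ge0 ?oppr_ge0 ?(ltW c0)//.
rewrite hnorm_shift_sqr// exprMn sqrrN lerDr.
rewrite -mulrA -mulrN -mulNr addr_ge0 ?sqr_ge0// mulr_ge0// mulr_ge0 ?sqr_ge0//.
by rewrite oppr_ge0 ltW.
Qed.

End bounded_self_adjoint.

(** * Spectrum *)

Section self_adjoint_spectrum.
Context {R : realType} {H : hilbertType R}.
Implicit Types (B : {linear H -> H}) (c k : R).

(** Banach's fixed point theorem for the complex normed module [H], the iterates
    being started at 0.  They stay in the ball of radius D around 0, which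
    bounds the tail of the sequence without summing a geometric series. *)
Lemma contraction_fixed_point (f : H -> H) (q : R) : 0 <= q < 1 ->
  (forall x y, hnorm (f x - f y) <= q * hnorm (x - y)) ->
  exists x, f x = x.
Proof.
move=> /andP[q0 q1] fq; pose y n := iter n f 0.
have q1' : 0 < 1 - q by rewrite subr_gt0.
pose D := hnorm (f 0) / (1 - q).
have D0 : 0 <= D by rewrite divr_ge0 ?hnorm_ge0// ltW.
have yD m : hnorm (y m) <= D.
  elim: m => [|m ih]; first by rewrite hnorm0.
  have -> : y m.+1 = (f (y m) - f 0) + f 0 by rewrite subrK.
  apply: le_trans (ler_hnormD _ _) _.
  have f0D : hnorm (f 0) = D - q * D.
    by rewrite -{1}[D]mul1r -mulrBl mulrC divfK// gt_eqF.
  rewrite f0D addrCA gerDl subr_le0 (le_trans (fq _ _))// subr0.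
  exact: ler_wpM2l.
have ydist n m : hnorm (y (n + m)%N - y n) <= q ^+ n * D.
  elim: n => [|n ih]; first by rewrite add0n subr0 mul1r.
  rewrite exprS -mulrA (le_trans (fq _ _))//.
  exact: ler_wpM2l.
have geo e : 0 < e -> exists N, q ^+ N * D < e.
  move=> e0; have : (fun n => q ^+ n * D) @ \oo --> 0 * D.
    by apply: cvgMr_tmp; have := @cvg_expr R q; rewrite ger0_norm//; exact.
  rewrite mul0r => /cvgrPdist_lt /(_ _ e0)[N _ /(_ N (leqnn N))] /=.
  rewrite sub0r normrN ger0_norm; first by move=> NP; exists N.
  by rewrite mulr_ge0// exprn_ge0.
have yc : cvgn y.
  apply: cauchy_cvg; apply: cauchy_exP => e e0.
  have eR : e = (complex.Re e)%:C by rewrite RRe_real// gtr0_real.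
  have [N NE] : exists N, q ^+ N * D < complex.Re e.
    by apply: geo; rewrite -ltcR -eR.
  exists (y N), N => // n /= Nn.
  rewrite -ball_normE /ball_/= hnormE eR ltcR hdistC -(subnKC Nn).
  exact: le_lt_trans (ydist _ _) _.
pose l := limn y.
have yl e : 0 < e -> exists N, forall n, (N <= n)%N -> hnorm (l - y n) < e.
  move=> e0; have e0C : 0 < e%:C by rewrite ltcR.
  move/cvgrPdist_lt : yc => /(_ _ e0C)[N _ NP]; exists N => n Nn.
  by have := NP n Nn; rewrite hnormE ltcR.
exists l; apply/eqP; rewrite -subr_eq0; apply/eqP/hnorm_eq0/eqP.
rewrite eq_le hnorm_ge0 andbT; apply/ler_addgt0Pl => e e0; rewrite addr0.
have [N NP] := yl (e / 2) (divr_gt0 e0 (ltr0n _ 2)).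
have -> : f l - l = (f l - f (y N)) - (l - y N.+1) by rewrite opprB addrA subrK.
apply: le_trans (ler_hnormB _ _) _; rewrite [leRHS]splitr lerD//; last first.
  by apply/ltW/NP.
apply: le_trans (fq _ _) _; rewrite -[leRHS]mul1r.
by rewrite ler_pM ?hnorm_ge0// ltW// NP.
Qed.

(** The equation B^2 x = y is solved as a fixed point of
    x - tau B^2 x + tau y, so that completeness is used directly and no
    orthogonal complement of the range is needed. *)
Lemma self_adjoint_surjective B : bounded_op B -> self_adjoint B ->
  bounded_below B -> forall y, exists x, B x = y.
Proof.
move=> Bb Bs Bd y.
pose K := opnorm B ^+ 2 + 1.
have K1 : 1 <= K by rewrite lerDr sqr_ge0.
have K0 : 0 < K by exact: lt_le_trans ltr01 _.
have [d d0 Bd'] := Bd.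
pose f x := x - K^-1%:C *: B (B x) + K^-1%:C *: y.
(* With tau = 1 / K, the squared norm of 1 - tau B^2 is at most 1 - tau d^2:
   the term tau^2 |B^2 x|^2 is absorbed by one of the two tau |B x|^2. *)
have fle x : hnorm (x - K^-1%:C *: B (B x)) ^+ 2 <=
    (1 - K^-1 * d ^+ 2) * hnorm x ^+ 2.
  have -> : x - K^-1%:C *: B (B x) = - (K^-1%:C *: shift (B \o B) K x).
    by rewrite /shift scalerBr scalerA -rmorphM mulVf ?gt_eqF//= scale1r opprB.
  rewrite hnorm_opp hnormZ exprMn real_normK ?num_real// hnorm_shift_sqr//.
  have h1 : hnorm (B (B x)) ^+ 2 <= K * hnorm (B x) ^+ 2.
    rewrite (@le_trans _ _ ((opnorm B * hnorm (B x)) ^+ 2))//.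
      by rewrite lerXn2r ?nnegrE ?mulr_ge0 ?opnorm_ge0 ?hnorm_ge0 ?bounded_opP.
    by rewrite exprMn ler_wpM2r ?sqr_ge0// lerDl.
  have h2 : d ^+ 2 * hnorm x ^+ 2 <= hnorm (B x) ^+ 2.
    rewrite -exprMn lerXn2r ?nnegrE ?mulr_ge0 ?hnorm_ge0//; exact: ltW.
  set u := hnorm (B (B x)) ^+ 2 in h1 *; set v := hnorm (B x) ^+ 2 in h1 h2 *.
  set w := hnorm x ^+ 2 in h2 *.
  have -> : (1 - K^-1 * d ^+ 2) * w =
      K^-1 ^+ 2 * (K ^+ 2 * w - K * (d ^+ 2 * w)).
    by field; rewrite gt_eqF.
  rewrite ler_wpM2l ?sqr_ge0//.
  have : K * (d ^+ 2 * w) <= K * v by rewrite ler_pM2l.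
  lra.
have q1 : 1 - K^-1 * d ^+ 2 < 1.
  by rewrite ltrBlDr ltrDl mulr_gt0 ?invr_gt0 ?exprn_gt0.
pose q := Num.sqrt (1 - K^-1 * d ^+ 2).
have [x fx] : exists x, f x = x.
  apply: (@contraction_fixed_point f q).
    by rewrite sqrtr_ge0/= -sqrtr1 ltr_sqrt.
  move=> u v.
  have -> : f u - f v = (u - v) - K^-1%:C *: B (B (u - v)).
    rewrite /f !linearB/= opprD addrACA subrr addr0 opprD addrACA.
    by rewrite -linearB.
  exact: hnorm_le_sqrt.
exists (B x); apply/eqP; rewrite -subr_eq0.
have : K^-1%:C *: (B (B x) - y) = 0.
  apply/eqP; rewrite -oppr_eq0 scalerBr opprB; apply/eqP.
  move/eqP : fx; rewrite /f -addrA -subr_eq0 addrAC subrr add0r addrC.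
  by move/eqP.
move=> /eqP; rewrite scaler_eq0 => /orP[/eqP[]/eqP|//].
by rewrite invr_eq0 gt_eqF.
Qed.

Lemma self_adjoint_inverse B : bounded_op B -> self_adjoint B ->
  bounded_below B -> exists S : {linear H -> H},
    [/\ bounded_op S, cancel B S & cancel S B].
Proof.
move=> Bb Bs Bd.
have [S SK] := choice (self_adjoint_surjective Bb Bs Bd).
have SlinP : linear S.
  by move=> a x y; apply: (bounded_below_inj Bd); rewrite linearP/= !SK.
pose Slin := GRing.isLinear.Build R[i] H H *:%R S SlinP.
pose S' : {linear H -> H} := HB.pack S Slin.
exists S'; split => //=.
- have [d d0 Bd'] := Bd; exists d^-1 => x.
  by rewrite ler_pdivlMl// -[in leRHS](SK x).
- by move=> x; apply: (bounded_below_inj Bd); rewrite SK.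
Qed.

Lemma real_spectrumP B c : bounded_op B -> self_adjoint B ->
  real_spectrum B c <-> ~ bounded_below (shift B c).
Proof.
move=> Bb Bs.
have shiftE x : c%:C *: x - B x = - shift B c x by rewrite /shift opprB.
split=> [cB Bd|Bd [S [[M SM] SK _]]].
- apply: cB.
  have [S [Sb SK KS]] := self_adjoint_inverse (bounded_shift c Bb)
    (self_adjoint_shift c Bs) Bd.
  exists (\- S); split=> [|x|x].
  + by have [M SM] := Sb; exists M => x; rewrite /= hnorm_opp.
  + by rewrite /= shiftE linearN opprK SK.
  + by rewrite /= shiftE linearN/= opprK KS.
- apply: Bd; exists (`|M| + 1)^-1; first by rewrite invr_gt0 ltr_pwDr.
  move=> x; rewrite ler_pdivrMl ?ltr_pwDr// -[in leLHS](SK x) shiftE.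
  rewrite linearN hnorm_opp (le_trans (SM _))// ler_wpM2r ?hnorm_ge0//.
  by rewrite (le_trans (ler_norm M))// lerDl.
Qed.

(** Put N = ||B||.  A unit vector x with |B x| close to N is almost killed by
    (B - N)(B + N), because
      |(B^2 - N^2) x|^2 = |B^2 x|^2 - 2 N^2 |B x|^2 + N^4
    is at most N^2 (N^2 - |B x|^2). *)
Lemma opnorm_approximate_eigenvalue B : bounded_op B -> self_adjoint B ->
  0 < opnorm B -> bounded_below (shift B (opnorm B)) ->
  bounded_below (shift B (- opnorm B)) -> False.
Proof.
move=> Bb Bs N0 Bp Bm; set N := opnorm B in N0 Bp Bm.
have [d d0 Bd] := bounded_below_comp Bp Bm.
pose k := N ^+ 2 - d ^+ 2 / N ^+ 2.
have NN0 : 0 < N ^+ 2 by rewrite exprn_gt0.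
(* A lower bound d on B^2 - N^2 makes sqrt k < N a bound of B. *)
have Bk x : hnorm (B x) ^+ 2 <= k * hnorm x ^+ 2.
  have h1 : hnorm (B (B x)) ^+ 2 <= N ^+ 2 * hnorm (B x) ^+ 2.
    rewrite -exprMn lerXn2r ?nnegrE ?mulr_ge0 ?hnorm_ge0 ?bounded_opP//.
    exact: ltW.
  have h2 : d ^+ 2 * hnorm x ^+ 2 <= hnorm (shift (B \o B) (N ^+ 2) x) ^+ 2.
    rewrite -exprMn lerXn2r ?nnegrE ?mulr_ge0 ?hnorm_ge0 ?(ltW d0)//.
    by rewrite shift_sqr_factor Bd.
  rewrite hnorm_shift_sqr// in h2.
  rewrite -(ler_pM2l NN0).
  have -> : N ^+ 2 * (k * hnorm x ^+ 2) =
      (N ^+ 2) ^+ 2 * hnorm x ^+ 2 - d ^+ 2 * hnorm x ^+ 2.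
    by rewrite /k; field; rewrite gt_eqF.
  lra.
have kN : Num.sqrt k < N.
  rewrite -[ltRHS]ger0_norm ?ltW// -sqrtr_sqr ltr_sqrt// ltrBlDr ltrDl.
  by rewrite divr_gt0 ?exprn_gt0.
have : opnorm B <= Num.sqrt k; last by rewrite leNgt kN.
by apply: opnorm_le (sqrtr_ge0 _) _ => x; exact: hnorm_le_sqrt.
Qed.

(** Here [e] is a point of the spectrum of B at minimal distance to 0.  As
    B^2 <= L, the operator B^2 - L is negative, and N = ||B^2 - L|| is an
    approximate eigenvalue of L - B^2; so L - N is one of B^2, and one of its
    square roots is one of B, which gives e^2 <= L - N.  Conversely, an
    approximate eigenvector of B for [e] is one of B^2 - L for e^2 - L. *)
Lemma opnorm_shift_sqr B e L : bounded_op B -> self_adjoint B ->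
  opnorm B ^+ 2 < L ->
  ~ bounded_below (shift B e) ->
  (forall s, `|s| < `|e| -> bounded_below (shift B s)) ->
  opnorm (shift (B \o B) L) = L - e ^+ 2.
Proof.
move=> Bb Bs BL Be Bgap; set P := shift (B \o B) L.
have Pb : bounded_op P by apply/bounded_shift/bounded_sqr.
have Ps : self_adjoint P by apply/self_adjoint_shift/self_adjoint_sqr.
have eB : `|e| <= opnorm B.
  by rewrite leNgt; apply/negP => /(bounded_below_shift (bounded_opP Bb)).
have eL : e ^+ 2 < L.
  rewrite -real_normK ?num_real//; apply: le_lt_trans BL.
  by rewrite lerXn2r ?nnegrE ?opnorm_ge0.
have N0 := opnorm_ge0 Pb.
apply/eqP; rewrite eq_le; apply/andP; split; rewrite leNgt; apply/negP => PN.
- have N0' : 0 < opnorm P by apply: lt_trans PN; rewrite subr_gt0.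
  apply: (opnorm_approximate_eigenvalue Pb Ps N0').
  + apply: (@bounded_below_ext _ _ (shift (B \o B) (L + opnorm P))) => [x|].
      by rewrite [RHS]shift_shift.
    apply: (@bounded_below_shift _ _ (B \o B) _ (opnorm B ^+ 2)).
      exact: hnorm_comp_le.
    apply: lt_le_trans BL _; apply: le_trans (ler_norm _).
    by rewrite lerDl.
  + apply: (@bounded_below_ext _ _ (shift (B \o B) (L - opnorm P))) => [x|].
      by rewrite [RHS]shift_shift.
    have [LN|LN] := ltP (L - opnorm P) 0.
      exact: bounded_below_shift_sqr_lt0.
    pose s := Num.sqrt (L - opnorm P).
    have se : `|s| < `|e|.
      rewrite ger0_norm ?sqrtr_ge0// -sqrtr_sqr ltr_sqrt; last lra.
      have : 0 <= e ^+ 2 by exact: sqr_ge0.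
      lra.
    apply: (@bounded_below_ext _ _ (shift B s \o shift B (- s))) => [x|].
      by rewrite /= -shift_sqr_factor sqr_sqrtr.
    by apply: bounded_below_comp; apply: Bgap; rewrite ?normrN.
- apply: Be; pose k := opnorm (shift B (- e)).
  have k0 : 0 <= k by apply/opnorm_ge0/bounded_shift.
  exists ((L - e ^+ 2 - opnorm P) / (k + 1)).
    by rewrite divr_gt0 ?subr_gt0// ltr_pwDr.
  move=> x; rewrite mulrAC ler_pdivrMr ?ltr_pwDr//.
  have h : (L - e ^+ 2) * hnorm x <=
      k * hnorm (shift B e x) + opnorm P * hnorm x.
    rewrite -[L - _]ger0_norm; last by rewrite subr_ge0 ltW.
    rewrite -hnormZ.
    have -> : (L - e ^+ 2)%:C *: x = shift B (- e) (shift B e x) - P x.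
      have := shift_sqr_factor B (- e) x; rewrite opprK sqrrN => <-.
      by rewrite /P /shift rmorphB/= scalerBl opprB [RHS]addrC addrA subrK.
    apply: le_trans (ler_hnormB _ _) _.
    by rewrite lerD// bounded_opP//; exact: bounded_shift.
  have := hnorm_ge0 (shift B e x).
  lra.
Qed.

End self_adjoint_spectrum.

(** * Gaps and quadratic polynomials *)

(** The polynomial (X - c)^2 - L, given by its coefficients because [poly_op]
    is a sum over them. *)
Definition quadratic (R : realType) (c L : R) : {poly R} :=
  Poly [:: c ^+ 2 - L; - (2 * c); 1].

Section quadratic.
Context {R : realType}.
Implicit Types c L e : R.

Lemma quadraticE c L : quadratic c L = [:: c ^+ 2 - L; - (2 * c); 1] :> seq R.
Proof. by rewrite (@PolyK _ 0)//= oner_neq0. Qed.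

Lemma poly_op_quadratic (H : hilbertType R) (A : {linear H -> H}) c L :
  poly_op (quadratic c L) A = shift (shift A c \o shift A c) L.
Proof.
apply/funext => x.
have -> : shift (shift A c \o shift A c) L x =
  shift A c (shift A c x) - L%:C *: x by [].
rewrite shift_comp /poly_op quadraticE/= !big_ord_recl big_ord0/= addr0.
rewrite rmorphB rmorphN rmorph1 scale1r scalerBl scaleNr -expr2.
by rewrite -mulr2n -[c *+ 2]mulr_natl/= [LHS]addrC [- _ + _]addrC addrA.
Qed.

(** The lower bound on [L] makes it exceed the squared norm of A - c, and the
    point [e] nearest to [c] becomes the point e - c nearest to 0. *)
Lemma opnorm_quadratic (H : hilbertType R) (A : {linear H -> H}) c L e :
  bounded_op A -> self_adjoint A -> (opnorm A + `|c|) ^+ 2 < L ->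
  real_spectrum A e ->
  (forall x, real_spectrum A x -> `|e - c| <= `|x - c|) ->
  opnorm (poly_op (quadratic c L) A) = L - (e - c) ^+ 2.
Proof.
move=> Ab As AL eA nearest; rewrite poly_op_quadratic.
have Ab' := bounded_shift c Ab.
have shiftA s : shift (shift A c) s =1 shift A (c + s) by apply: shift_shift.
apply: opnorm_shift_sqr => //.
- exact: self_adjoint_shift.
- apply: le_lt_trans AL.
  have c0 : 0 <= opnorm A + `|c| by rewrite addr_ge0 ?opnorm_ge0.
  rewrite lerXn2r ?nnegrE ?opnorm_ge0//; apply: opnorm_le => // x.
  by rewrite (le_trans (ler_hnormB _ _))// hnormZ mulrDl lerD ?bounded_opP.
- move/(bounded_below_ext (shiftA _)); rewrite addrC subrK.
  exact/real_spectrumP.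
- move=> s se; apply: (bounded_below_ext (fsym (shiftA s))).
  apply: contrapT => /real_spectrumP; move=> /(_ Ab As) /nearest.
  by rewrite addrAC subrr add0r leNgt se.
Qed.

Lemma gap_nearest_left (F : set R) a b c : gap F a b -> a <= c ->
  2 * c <= a + b -> forall x, F x -> `|a - c| <= `|x - c|.
Proof.
move=> [ab _ _ F0] ac cb x Fx.
have : ~~ (a < x < b).
  by apply/negP => xab; rewrite -[False]/((set0 : set R) x) -F0; split.
rewrite negb_and -!leNgt distrC ger0_norm ?subr_ge0// => /orP[xa|bx].
  rewrite distrC ger0_norm; lra.
rewrite ger0_norm; lra.
Qed.

Lemma gap_nearest_right (F : set R) a b c : gap F a b -> c <= b ->
  a + b <= 2 * c -> forall x, F x -> `|b - c| <= `|x - c|.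
Proof.
move=> [ab _ _ F0] ac cb x Fx.
have : ~~ (a < x < b).
  by apply/negP => xab; rewrite -[False]/((set0 : set R) x) -F0; split.
rewrite negb_and -!leNgt ger0_norm ?subr_ge0// => /orP[xa|bx].
  rewrite distrC ger0_norm; lra.
rewrite ger0_norm; lra.
Qed.

End quadratic.

(** * Hoelder continuity along the field *)

Section fields.
Context {R : realType} {T : metricType R}.
Variables (alpha : R) (H : T -> hilbertType R).
Variable A : forall t, {linear H t -> H t}.

Lemma p2_hoelder_bound (p : {poly R}) : p2_hoelder alpha A -> (size p <= 3)%N ->
  exists2 C : R, 0 <= C & forall s t,
    `|opnorm (poly_op p (A s)) - opnorm (poly_op p (A t))| <=
      C * mdist s t `^ alpha.
Proof.
move=> Ap2 p3; have p0 : 0 < poly_norm1 p + 1.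
  by rewrite ltr_pwDr// sumr_ge0.
have := Ap2 _ p0; rewrite /uniformly_hoelder; set S := ereal_sup _ => Slt.
have Sle s t : s != t ->
    ((`|opnorm (poly_op p (A s)) - opnorm (poly_op p (A t))| /
      mdist s t `^ alpha)%:E <= S)%E.
  move=> st; pose f := fun t => opnorm (poly_op p (A t)) : R^o.
  apply: (@le_trans _ _ (hoelder_const alpha f)); last first.
    apply: ereal_sup_ubound; exists f => //; exists p => //.
    by split=> //; rewrite lerDl.
  by apply: ereal_sup_ubound; exists (s, t) => //=; rewrite distrC.
(* If T has one point then S is -oo, and the constant 0 is used. *)
exists `|fine S| => [//|s t].
have [->|st] := eqVneq s t.
  by rewrite subrr normr0 mulr_ge0// powR_ge0.
rewrite -ler_pdivrMr ?powR_gt0 ?mdist_gt0//.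
apply: le_trans (ler_norm _); rewrite -lee_fin fineK ?Sle//.
by rewrite fin_numElt Slt andbT (lt_le_trans _ (Sle _ _ st))// ltNyr.
Qed.

(** A point [e t] of the spectrum nearest to [c] inherits the Hoelder bound of
    (e t - c)^2, because the difference of two squares is e t - e t0 times
    e t + e t0 - 2 c, and [g] keeps the second factor away from 0. *)
Lemma nearest_point_hoelder (e : T -> R) (c g : R) (Q : set T) (t0 : T) :
  (forall t, bounded_op (A t)) -> (forall t, self_adjoint (A t)) ->
  (exists M : R, forall t, opnorm (A t) <= M) -> p2_hoelder alpha A ->
  (forall t, Q t -> real_spectrum (A t) (e t)) ->
  (forall t, Q t ->
    forall x, real_spectrum (A t) x -> `|e t - c| <= `|x - c|) ->
  0 < g -> Q t0 -> (forall t, Q t -> g <= `|(e t - c) + (e t0 - c)|) ->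
  exists2 C : R, 0 <= C & forall t, Q t ->
    `|e t - e t0| <= C * mdist t t0 `^ alpha.
Proof.
move=> Ab As [M AM] Ap2 eA nearest g0 Qt0 gQ.
pose L := (M + `|c|) ^+ 2 + 1.
have AL t : (opnorm (A t) + `|c|) ^+ 2 < L.
  have A0 := opnorm_ge0 (Ab t); have M0 := le_trans A0 (AM t).
  rewrite ltr_pwDr// lerXn2r ?nnegrE ?addr_ge0//.
  by rewrite lerD2r.
have [|C C0 CP] := p2_hoelder_bound (p := quadratic c L) Ap2.
  by rewrite quadraticE.
exists (C / g) => [|t Qt]; first by rewrite divr_ge0// ltW.
rewrite mulrAC ler_pdivlMr// (le_trans _ (CP t t0))//.
rewrite (opnorm_quadratic (Ab t) (As t) (AL t) (eA _ Qt) (nearest _ Qt)).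
rewrite (opnorm_quadratic (Ab t0) (As t0) (AL t0) (eA _ Qt0) (nearest _ Qt0)).
have -> : L - (e t - c) ^+ 2 - (L - (e t0 - c) ^+ 2) =
   - ((e t - e t0) * ((e t - c) + (e t0 - c))) by ring.
by rewrite normrN normrM ler_wpM2l// gQ.
Qed.

End fields.

Theorem theorem4 (R : realType) (T : completeMetricType R) (alpha : R)
    (alpha_gt0 : 0 < alpha)
    (H : T -> hilbertType R) (A : forall t, {linear H t -> H t})
    (A_bounded : forall t, bounded_op (A t))
    (A_self_adjoint : forall t, self_adjoint (A t))
    (A_unif_bounded : exists M : R, forall t, opnorm (A t) <= M)
    (A_p2 : p2_hoelder alpha A)
    (t0 : T) (W : set T) (W_nbhs : nbhs t0 W)
    (a b : T -> R)
    (ab_gap : forall t, W t -> gap (real_spectrum (A t)) (a t) (b t))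
    (a_lim : a t @[t --> t0] --> a t0)
    (b_lim : b t @[t --> t0] --> b t0) :
  exists C r : R, [/\ 0 <= C, 0 < r &
    forall t, W t -> mdist t t0 < r ->
      `|a t - a t0| <= C * mdist t t0 `^ alpha /\
      `|b t - b t0| <= C * mdist t t0 `^ alpha].
Proof.
have Wt0 := nbhs_singleton W_nbhs.
pose g := b t0 - a t0.
have g0 : 0 < g by have [ab _ _ _] := ab_gap _ Wt0; rewrite subr_gt0.
have gE : b t0 = a t0 + g by rewrite addrC subrK.
have g8 : 0 < g / 8 by lra.
(* Moving both edges by less than an eighth of the gap leaves a_{t0} + g / 4
   nearer to the lower edge, b_{t0} - g / 4 nearer to the upper one. *)
pose Q := [set t | [/\ W t, `|a t0 - a t| < g / 8 & `|b t0 - b t| < g / 8]].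
have Qt0 : Q t0 by split; rewrite ?subrr ?normr0.
have [r r0 rQ] : exists2 r, 0 < r & forall t, W t -> mdist t t0 < r -> Q t.
  have /nbhs_ballP[r /= r0 rP] : \forall t \near t0,
      `|a t0 - a t| < g / 8 /\ `|b t0 - b t| < g / 8.
    near=> t; split; near: t.
      by move/cvgrPdist_lt : a_lim; apply.
    by move/cvgrPdist_lt : b_lim; apply.
  exists r => // t Wt tr; have [|a_t bt] := rP t; last by split.
  by rewrite ballEmdist/= metric_sym.
have Qgap t : Q t -> [/\ gap (real_spectrum (A t)) (a t) (b t),
    a t0 - g / 8 < a t < a t0 + g / 8 & b t0 - g / 8 < b t < b t0 + g / 8].
  move=> [Wt]; rewrite distrC ltr_distl => a_t; rewrite distrC ltr_distl => bt.
  by split=> //; exact: ab_gap.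
have [||||t Qt|Ca Ca0 CaP] :=
  @nearest_point_hoelder _ _ _ _ _ a (a t0 + g / 4) (g / 4) Q t0 A_bounded
  A_self_adjoint A_unif_bounded A_p2.
- by move=> t /Qgap[[]].
- move=> t /Qgap[abt /andP[a1 a2] /andP[b1 b2]].
  apply: gap_nearest_left abt _ _; lra.
- lra.
- by [].
- have [_ /andP[a1 a2] /andP[b1 b2]] := Qgap _ Qt; rewrite ler0_norm; lra.
have [||||t Qt|Cb Cb0 CbP] :=
  @nearest_point_hoelder _ _ _ _ _ b (b t0 - g / 4) (g / 4) Q t0 A_bounded
  A_self_adjoint A_unif_bounded A_p2.
- by move=> t /Qgap[[]].
- move=> t /Qgap[abt /andP[a1 a2] /andP[b1 b2]].
  apply: gap_nearest_right abt _ _; lra.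
- lra.
- by [].
- have [_ /andP[a1 a2] /andP[b1 b2]] := Qgap _ Qt; rewrite ger0_norm; lra.
exists (Ca + Cb), r; split=> //; first exact: addr_ge0.
move=> t Wt tr; have Qt := rQ _ Wt tr.
have d0 : 0 <= mdist t t0 `^ alpha by rewrite powR_ge0.
split; [apply: le_trans (CaP t Qt) _|apply: le_trans (CbP t Qt) _];
  by rewrite ler_wpM2r// ?lerDl ?lerDr.
Unshelve. all: by end_near. Qed.
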